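(* Let $(\mathfrak g,A)$ be a Lie superalgebroid. Then any $(\mathfrak g,A)$-complex $(\Omega,d)$ extends uniquely to a calculus structure of the Gerstenhaber algebra $\mathcal G=S_A(\Pi\mathfrak g)$ on the complex $(\Omega,d)$. Moreover, the contraction $\iota_\cdot$ and the Lie derivative $L_\cdot$ of this calculus structure satisfy the $0$-right Leibniz rule: for all homogeneous $X,Y\in\mathcal G$, $$L_{X\wedge Y}=\iota_XL_Y+(-1)^{p(Y)}L_X\iota_Y .$$
   Context: $\mathbb F$ is a field of characteristic $0$. For a vector superspace $V$ with parity $p$, $\Pi V$ is the same space with parity $\bar p=p+\bar 1$. $\mathrm{End}(V)$ is a Lie superalgebra with $[P,Q]=PQ-(-1)^{p(P)p(Q)}QP$. The parity of a Lie superalgebra $\mathfrak g$ is denoted $\bar p$, that of $\Pi\mathfrak g$ is denoted $p$. A *complex* $(\Omega,d)$ is a vector superspace $\Omega$ with an odd endomorphism $d$ with $d^2=0$. A *Lie superalgebroid* $(\mathfrak g,A)$: $\mathfrak g$ is a Lie superalgebra, $A$ is a (purely even) commutative associative algebra, $\mathfrak g$ is a left $A$-module, $A$ is a left $\mathfrak g$-module, and for $X,Y\in\mathfrak g$, $f,g\in A$: $(fX)(g)=f(X(g))$, $X(fg)=X(f)g+fX(g)$, $[X,fY]=X(f)Y+f[X,Y]$. The Lie superalgebra $\mathfrak g\ltimes\Pi A$ is $\mathfrak g\oplus\Pi A$ with bracket extending that of $\mathfrak g$ by $[f,g]=0$, $[X,f]=X(f)$, and $[f,X]$ determined by skewcommutativity.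 For a Lie superalgebra $\mathfrak h$, an *$\mathfrak h$-complex* is a complex $(\Omega,d)$ with an even linear map $\iota_\cdot:\Pi\mathfrak h\to\mathrm{End}(\Omega)$ such that $[\iota_X,\iota_Y]=0$ and $[[\iota_X,d],\iota_Y]=\iota_{[X,Y]}$ for all $X,Y\in\mathfrak h$. A *$(\mathfrak g,A)$-complex* is a $\mathfrak g\ltimes\Pi A$-complex $(\Omega,d)$ whose map $\iota_\cdot:\Pi\mathfrak g\oplus A\to\mathrm{End}(\Omega)$ satisfies $\iota_{fg}=\iota_f\iota_g$ and $\iota_{fX}=\iota_f\iota_X$ for $f,g\in A$, $X\in\mathfrak g$. A *Gerstenhaber algebra* is a vector superspace $\mathcal G$ with parity $p$, a product $\wedge$ and a bracket $[\cdot,\cdot]$ such that $(\mathcal G,\wedge)$ is a commutative associative superalgebra, $(\Pi\mathcal G,[\cdot,\cdot])$ is a Lie superalgebra, and $[X,Y\wedge Z]=[X,Y]\wedge Z+(-1)^{(p(X)+\bar 1)p(Y)}Y\wedge[X,Z]$. $S_A(\Pi\mathfrak g)$ (symmetric superalgebra over $A$ of the $A$-module $\Pi\mathfrak g$, with degree-$0$ part $A$) is the Gerstenhaber algebra whose $\wedge$ is the product of the symmetric superalgebra and whose bracket (the Schouten bracket) is the unique Gerstenhaber bracket extending the bracket of $\mathfrak g\ltimes\Pi A$. A *representation* of a Gerstenhaber algebra $\mathcal G$ on a superspace $V$ is a module structure $X\mapsto\iota_X$ (contraction) over the superalgebra $(\mathcal G,\wedge)$ together with a module structure $X\mapsto L_X$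 (Lie derivative) over the Lie superalgebra $(\Pi\mathcal G,[\cdot,\cdot])$ such that $[L_X,\iota_Y]=\iota_{[X,Y]}$. A *calculus structure* of $\mathcal G$ on a complex $(\Omega,d)$ is a representation of $\mathcal G$ on $\Omega$ satisfying Cartan's formula $L_X=[\iota_X,d]$ for all $X\in\mathcal G$. ''Extends'' means that the contraction restricts to the given $\iota_\cdot$ on $\Pi\mathfrak g\oplus A$. *)

(* Defs.v *)
From HB Require Import structures.
From mathcomp Require Import all_boot all_order all_algebra.
From mathcomp Require Import ring.

Set Implicit Arguments.
Unset Strict Implicit.
Unset Printing Implicit Defensive.

Import GRing.Theory.
Local Open Scope ring_scope.

(* Parities are booleans: [false] is even, [true] is odd, [a (+) b] is the sum
   of parities, and the sign (-1)^{p(x)p(y)} is [(-1) ^+ (a && b)].  Identities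
   involving signs are stated for homogeneous elements of explicit parity, and
   extend to all elements by (bi)linearity. *)

Definition bilinear_map (F : fieldType) (U V W : lmodType F)
    (f : U -> V -> W) : Prop :=
  (forall u, linear (f u)) /\ (forall v, linear (f^~ v)).

(* [par V b v] : the vector v lies in the homogeneous component V_b. *)
Record superspace (F : fieldType) := Superspace {
  superspace_sort :> lmodType F;
  par : bool -> superspace_sort -> Prop;
  par_zero : forall b, par b 0;
  par_comb : forall b (c : F) u v, par b u -> par b v -> par b (c *: u + v);
  par_sum : forall v, exists u w, [/\ par false u, par true w & v = u + w];
  par_cap : forall v, par false v -> par true v -> v = 0 }.

Section Superspaces.
Variable F : fieldType.

Lemma parity_shift_sum (V : superspace F) (v : V) :
  exists u w, [/\ par (~~ false) u, par (~~ true) w & v = u + w].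
Proof.
by have [u [w [hu hw ->]]] := par_sum v; exists w, u; split; rewrite // addrC.
Qed.

Definition Pi (V : superspace F) : superspace F :=
  @Superspace F V (fun b v => par (~~ b) v)
    (fun b => par_zero V (~~ b)) (fun b => @par_comb F V (~~ b))
    (@parity_shift_sum V) (fun v h1 h0 => @par_cap F V v h0 h1).

Section Even.
Variable V : lmodType F.

Definition even_par (b : bool) (v : V) : Prop := if b then v = 0 else True.

Lemma even_par_zero b : even_par b 0. Proof. by case: b. Qed.

Lemma even_par_comb b (c : F) u v :
  even_par b u -> even_par b v -> even_par b (c *: u + v).
Proof. by case: b => //= -> ->; rewrite scaler0 addr0. Qed.

Lemma even_par_sum v :
  exists u w, [/\ even_par false u, even_par true w & v = u + w].
Proof. by exists v, 0; rewrite addr0. Qed.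

Lemma even_par_cap v : even_par false v -> even_par true v -> v = 0.
Proof. by []. Qed.

Definition purely_even : superspace F :=
  Superspace even_par_zero even_par_comb even_par_sum even_par_cap.
End Even.

Section DirectSum.
Variables V W : superspace F.

Definition dsum_par (b : bool) (x : V * W) : Prop := par b x.1 /\ par b x.2.

Lemma dsum_par_zero b : dsum_par b 0.
Proof. by split; apply: par_zero. Qed.

Lemma dsum_par_comb b (c : F) x y :
  dsum_par b x -> dsum_par b y -> dsum_par b (c *: x + y).
Proof. by move=> [x1 x2] [y1 y2]; split; apply: par_comb. Qed.

Lemma dsum_par_sum x :
  exists u w, [/\ dsum_par false u, dsum_par true w & x = u + w].
Proof.
case: x => v w.
have [v0 [v1 [hv0 hv1 ->]]] := par_sum v.
have [w0 [w1 [hw0 hw1 ->]]] := par_sum w.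
by exists (v0, w0), (v1, w1).
Qed.

Lemma dsum_par_cap x : dsum_par false x -> dsum_par true x -> x = 0.
Proof.
by case: x => v w [/= v0 w0] [/= v1 w1]; rewrite (par_cap v0 v1) (par_cap w0 w1).
Qed.

Definition direct_sum : superspace F :=
  Superspace dsum_par_zero dsum_par_comb dsum_par_sum dsum_par_cap.
End DirectSum.

(* The linear endomorphism P of V is homogeneous of parity a in End(V). *)
Definition End_par (V : superspace F) (a : bool) (P : V -> V) : Prop :=
  forall b v, par b v -> par (a (+) b) (P v).

(* The bracket [P,Q] in End(V) of P of parity a and Q of parity b. *)
Definition supercomm (V : superspace F) (a b : bool) (P Q : V -> V) : V -> V :=
  fun v => P (Q v) - (-1) ^+ (a && b) *: Q (P v).

End Superspaces.

Record is_lie_superalgebra (F : fieldType) (V : superspace F)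
    (br : V -> V -> V) : Prop := {
  lie_bilinear : bilinear_map br;
  lie_even : forall a b x y, par a x -> par b y -> par (a (+) b) (br x y);
  lie_skew : forall a b x y, par a x -> par b y ->
    br x y = - ((-1) ^+ (a && b) *: br y x);
  lie_jacobi : forall a b x y z, par a x -> par b y ->
    br x (br y z) = br (br x y) z + (-1) ^+ (a && b) *: br y (br x z) }.

Record lie_superalgebra (F : fieldType) := LieSuperalgebra {
  lie_space :> superspace F;
  bracket : lie_space -> lie_space -> lie_space;
  bracketP : is_lie_superalgebra bracket }.

(* Unital; 1 = 0 is allowed. *)
Record com_superalgebra (F : fieldType) := ComSuperalgebra {
  com_space :> superspace F;
  smul : com_space -> com_space -> com_space;
  sone : com_space;
  smul_bilinear : bilinear_map smul;
  smul_even : forall a b x y, par a x -> par b y -> par (a (+) b) (smul x y);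
  sone_even : par false sone;
  smulA : forall x y z, smul x (smul y z) = smul (smul x y) z;
  smul1 : forall x, smul sone x = x;
  smulC : forall a b x y, par a x -> par b y ->
    smul x y = (-1) ^+ (a && b) *: smul y x }.

Record is_superalgebra_morphism (F : fieldType) (B C : com_superalgebra F)
    (h : B -> C) : Prop := {
  smorph_linear : linear h;
  smorph_even : forall b x, par b x -> par b (h x);
  smorph_one : h (sone B) = sone C;
  smorph_mul : forall x y, h (smul x y) = smul (h x) (h y) }.

(* A : comAlgType F is regarded as the purely even superspace
   [purely_even A]; [amod f X] is fX and [anchor X f] is X(f). *)
Record lie_superalgebroid (F : fieldType) (g : lie_superalgebra F)
    (A : comAlgType F) := LieSuperalgebroid {
  amod : A -> g -> g;
  amod_bilinear : bilinear_map amod;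
  amod_even : forall f b X, par b X -> par b (amod f X);
  amod1 : forall X, amod 1 X = X;
  amodA : forall f h X, amod (f * h) X = amod f (amod h X);
  anchor : g -> A -> A;
  anchor_bilinear : bilinear_map anchor;
  anchor_even : forall a b X f, par a X -> @par F (purely_even A) b f ->
    @par F (purely_even A) (a (+) b) (anchor X f);
  anchor_bracket : forall a b X Y f, par a X -> par b Y ->
    anchor (bracket X Y) f =
    anchor X (anchor Y f) - (-1) ^+ (a && b) *: anchor Y (anchor X f);
  anchor_amod : forall f X h, anchor (amod f X) h = f * anchor X h;
  anchor_mul : forall X f h, anchor X (f * h) = anchor X f * h + f * anchor X h;
  bracket_amod : forall X f Y,
    bracket X (amod f Y) = amod (anchor X f) Y + amod f (bracket X Y) }.

Section Semidirect.
Variables (F : fieldType) (g : lie_superalgebra F) (A : comAlgType F).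
Variable E : lie_superalgebroid g A.

Definition sdp_space : superspace F := direct_sum g (Pi (purely_even A)).

(* Skewcommutativity gives [f,Y] = - (-1)^{p(Y)} Y(f), where Y(f) = 0 for Y odd
   because A is purely even; hence [f,Y] = - Y(f) for all Y. *)
Definition sdp_bracket (x y : sdp_space) : sdp_space :=
  (bracket x.1 y.1, anchor E x.1 y.2 - anchor E y.1 x.2).

Lemma anchor_odd X (f : A) : par true X -> anchor E X f = 0.
Proof. by move=> hX; apply: (anchor_even (b := false) E hX). Qed.

Lemma anchorBr X : {morph anchor E X : f h / f - h}.
Proof.
have [aL _] := anchor_bilinear E.
by move=> f h; rewrite -scaleN1r addrC aL scaleN1r addrC.
Qed.

Lemma anchor0 X : anchor E X 0 = 0.
Proof. by rewrite -[0 in LHS](subrr 0) anchorBr subrr. Qed.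

Lemma anchorDl f : {morph anchor E^~ f : X Y / X + Y}.
Proof.
have [_ aR] := anchor_bilinear E.
by move=> X Y; have := aR f 1 X Y; rewrite /= !scale1r.
Qed.

Lemma anchor_comm X Y f :
  anchor E (bracket X Y) f = anchor E X (anchor E Y f) - anchor E Y (anchor E X f).
Proof.
have [brL brR] := lie_bilinear (bracketP g).
have brDr (Z : g) : {morph bracket Z : U V / U + V}.
  by move=> U V; have := brL Z 1 U V; rewrite !scale1r.
have brDl (Z : g) : {morph (@bracket F g)^~ Z : U V / U + V}.
  by move=> U V; have := brR Z 1 U V; rewrite /= !scale1r.
have hom a b (U V : g) : par a U -> par b V ->
    anchor E (bracket U V) f = anchor E U (anchor E V f) - anchor E V (anchor E U f).
  move=> hU hV; rewrite (anchor_bracket _ _ hU hV).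
  case: a b hU hV => [] [] hU hV; rewrite ?scale1r //.
  by rewrite !(anchor_odd _ hU) anchor0 scaler0 subr0.
have [X0 [X1 [hX0 hX1 ->]]] := par_sum X.
have [Y0 [Y1 [hY0 hY1 ->]]] := par_sum Y.
rewrite brDl !brDr !anchorDl (hom _ _ _ _ hX0 hY0) (hom _ _ _ _ hX0 hY1).
rewrite (hom _ _ _ _ hX1 hY0) (hom _ _ _ _ hX1 hY1).
by rewrite !(anchor_odd _ hX1) !(anchor_odd _ hY1) !(addr0, anchor0, subr0).
Qed.

Lemma sdp_bracketP : is_lie_superalgebra sdp_bracket.
Proof.
have [aL aR] := anchor_bilinear E.
have [[brL brR] br_ev br_sk br_ja] := bracketP g.
split.
- split=> [[X f] c [Y h] [Z k]|[X f] c [Y h] [Z k]]; congr pair => /=.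
  + exact: brL.
  + by rewrite aL aR /= scalerBr opprD addrACA.
  + exact: brR.
  + by rewrite aL aR /= scalerBr opprD addrACA.
- move=> a b [X f] [Y h] [/= hX hf] [/= hY hh]; split=> /=; first exact: br_ev.
  case: a b hX hf hY hh => [] [] hX hf hY hh //=.
  + by rewrite (anchor_odd _ hX) (anchor_odd _ hY) subrr.
  + by rewrite hf hh !anchor0 subrr.
- move=> a b [X f] [Y h] [/= hX hf] [/= hY hh]; congr pair => /=.
    exact: br_sk.
  case: a b hX hf hY hh => [] [] hX hf hY hh /=;
    rewrite ?(anchor_odd _ hX) ?(anchor_odd _ hY) ?subrr ?scaler0 ?oppr0 //;
    rewrite scale1r; ring.
- move=> a b [X f] [Y h] [Z k] [/= hX hf] [/= hY hh]; congr pair => /=.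
    exact: br_ja.
  rewrite !anchorBr !anchor_comm.
  case: a b hX hf hY hh => [] [] hX hf hY hh /=; rewrite ?scale1r; try ring.
  by rewrite !(anchor_odd _ hX) !(anchor_odd _ hY) anchor0 !subr0 scaler0 addr0.
Qed.

Definition semidirect : lie_superalgebra F := LieSuperalgebra sdp_bracketP.

End Semidirect.

Record complex (F : fieldType) := Complex {
  cx_space :> superspace F;
  diff : {linear cx_space -> cx_space};
  diff_odd : End_par true diff;
  diff_sq : forall v, diff (diff v) = 0 }.

(* For X of parity a in Pi h, the endomorphisms iota_X, d and [iota_X, d] have
   parities a, 1 and a + 1. *)
Record lie_complex (F : fieldType) (h : lie_superalgebra F) (Om : complex F) :=
    LieComplex {
  cx_iota : h -> {linear Om -> Om};
  cx_iota_linear : forall v, linear (fun X => cx_iota X v);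
  cx_iota_even : forall a X, @par F (Pi h) a X -> End_par a (cx_iota X);
  cx_iota_comm : forall a b X Y,
    @par F (Pi h) a X -> @par F (Pi h) b Y ->
    supercomm a b (cx_iota X) (cx_iota Y) =1 (fun=> 0);
  cx_iota_bracket : forall a b X Y,
    @par F (Pi h) a X -> @par F (Pi h) b Y ->
    supercomm (a (+) true) b (supercomm a true (cx_iota X) (diff Om)) (cx_iota Y)
    =1 cx_iota (bracket X Y) }.

Record algebroid_complex (F : fieldType) (g : lie_superalgebra F)
    (A : comAlgType F) (E : lie_superalgebroid g A) (Om : complex F) :=
    AlgebroidComplex {
  ac_complex :> lie_complex (semidirect E) Om;
  ac_iota_mul : forall f h : A,
    cx_iota ac_complex (0, f * h)
    =1 cx_iota ac_complex (0, f) \o cx_iota ac_complex (0, h);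
  ac_iota_amod : forall (f : A) (X : g),
    cx_iota ac_complex (amod E f X, 0)
    =1 cx_iota ac_complex (0, f) \o cx_iota ac_complex (X, 0) }.

Record is_gerstenhaber_bracket (F : fieldType) (G : com_superalgebra F)
    (br : G -> G -> G) : Prop := {
  ger_lie : @is_lie_superalgebra F (Pi G) br;
  ger_leibniz : forall a b (X Y Z : G), par a X -> par b Y ->
    br X (smul Y Z) =
    smul (br X Y) Z + (-1) ^+ ((a (+) true) && b) *: smul Y (br X Z) }.

Record gerstenhaber_algebra (F : fieldType) := GerstenhaberAlgebra {
  ger_alg :> com_superalgebra F;
  ger_bracket : ger_alg -> ger_alg -> ger_alg;
  ger_bracketP : is_gerstenhaber_bracket ger_bracket }.

(* B is a commutative superalgebra over A, by the unital morphism phi, and psi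
   is an even A-linear map from the A-module M to B. *)
Record is_superalgebra_under (F : fieldType) (A : comAlgType F)
    (M : superspace F) (act : A -> M -> M) (B : com_superalgebra F)
    (phi : A -> B) (psi : M -> B) : Prop := {
  under_linear : linear phi;
  under_even : forall f, par false (phi f);
  under_one : phi 1 = sone B;
  under_mul : forall f h, phi (f * h) = smul (phi f) (phi h);
  under_mod_linear : linear psi;
  under_mod_even : forall b x, par b x -> par b (psi x);
  under_act : forall f x, psi (act f x) = smul (phi f) (psi x) }.

(* The symmetric superalgebra S_A(M), given by its universal property. *)
Record symmetric_superalgebra (F : fieldType) (A : comAlgType F)
    (M : superspace F) (act : A -> M -> M) := SymmetricSuperalgebra {
  sym_alg :> com_superalgebra F;
  sym_scalar : A -> sym_alg;
  sym_gen : M -> sym_alg;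
  sym_under : is_superalgebra_under act sym_scalar sym_gen;
  sym_ex : forall (B : com_superalgebra F) (phi : A -> B) (psi : M -> B),
    is_superalgebra_under act phi psi ->
    exists h : sym_alg -> B,
      [/\ is_superalgebra_morphism h, h \o sym_scalar =1 phi & h \o sym_gen =1 psi];
  sym_uniq : forall (B : com_superalgebra F) (h1 h2 : sym_alg -> B),
    is_superalgebra_morphism h1 -> is_superalgebra_morphism h2 ->
    h1 \o sym_scalar =1 h2 \o sym_scalar -> h1 \o sym_gen =1 h2 \o sym_gen ->
    h1 =1 h2 }.

Section Schouten.
Variables (F : fieldType) (g : lie_superalgebra F) (A : comAlgType F).
Variable E : lie_superalgebroid g A.

(* The inclusion of Pi g (+) A, the superspace underlying Pi (g |x Pi A). *)
Definition sym_incl (S : @symmetric_superalgebra F A (Pi g) (amod E))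
  (x : semidirect E) : S := sym_gen S x.1 + sym_scalar S x.2.

Record schouten_algebra := SchoutenAlgebra {
  sch_sym : @symmetric_superalgebra F A (Pi g) (amod E);
  sch_bracket : sch_sym -> sch_sym -> sch_sym;
  sch_bracketP : is_gerstenhaber_bracket sch_bracket;
  sch_extends : forall x y : semidirect E,
    sch_bracket (sym_incl sch_sym x) (sym_incl sch_sym y)
    = sym_incl sch_sym (bracket x y) }.

Definition schouten_gerstenhaber (S : schouten_algebra) : gerstenhaber_algebra F :=
  GerstenhaberAlgebra (sch_bracketP S).
End Schouten.

(* No unit condition is imposed on iota: in an [algebroid_complex] iota_1 need
   not be the identity, and the two agree when the representation extends the
   complex. *)
Record representation (F : fieldType) (G : gerstenhaber_algebra F)
    (V : superspace F) := Representation {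
  contr : G -> {linear V -> V};
  contr_linear : forall v, linear (fun X => contr X v);
  contr_even : forall a X, par a X -> End_par a (contr X);
  contr_mul : forall X Y, contr (smul X Y) =1 contr X \o contr Y;
  lied : G -> {linear V -> V};
  lied_linear : forall v, linear (fun X => lied X v);
  lied_even : forall a X, @par F (Pi G) a X -> End_par a (lied X);
  lied_bracket : forall a b X Y, @par F (Pi G) a X -> @par F (Pi G) b Y ->
    lied (ger_bracket X Y) =1 supercomm a b (lied X) (lied Y);
  lied_contr : forall a b X Y, @par F (Pi G) a X -> par b Y ->
    supercomm a b (lied X) (contr Y) =1 contr (ger_bracket X Y) }.

Record calculus (F : fieldType) (G : gerstenhaber_algebra F) (Om : complex F) :=
    Calculus {
  calc_rep :> representation G Om;
  cartan : forall a X, par a X ->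
    lied calc_rep X =1 supercomm a true (contr calc_rep X) (diff Om) }.

Definition extends (F : fieldType) (g : lie_superalgebra F) (A : comAlgType F)
    (E : lie_superalgebroid g A) (S : schouten_algebra E) (Om : complex F)
    (io : algebroid_complex E Om) (C : calculus (schouten_gerstenhaber S) Om) : Prop :=
  forall x : semidirect E, contr C (sym_incl (sch_sym S) x) =1 cx_iota io x.

(* Main.v *)
(* The contraction of a symmetric superalgebra is determined by its values on
   the generators; it exists because the operators iota_x, with x homogeneous in
   Pi g (+) A, generate a commutative superalgebra, whose unit is iota_1 rather
   than the identity.  Cartan's formula then forces L_X = [iota_X, d].  The
   0-right Leibniz rule is [PQ, d] = P[Q, d] +- [P, d]Q.  The identity
   [L_X, iota_Y] = iota_[X,Y] holds on generators by hypothesis; it extends in Y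
   because both sides are derivations along iota, and in X by the 0-right Leibniz
   rule and the left Leibniz rule of the Schouten bracket.  Finally
   [L_X, L_Y] = L_[X,Y] by the Jacobi identity, since [L_X, d] = 0. *)
Require Import Defs.
From HB Require Import structures.
From mathcomp Require Import all_boot all_order all_algebra.
From mathcomp Require Import boolp functions.

Set Implicit Arguments.
Unset Strict Implicit.
Unset Printing Implicit Defensive.

Import GRing.Theory.
Local Open Scope ring_scope.

(** * Commutative superalgebras spanned by homogeneous elements of a space with a product *)

(** The laws are weak enough for two instances: [V] the symmetric superalgebra itself, and [V] the
    space of all functions [Om -> Om] under composition. Composition is linear in its right factor
    only when the left factor is linear, hence the restriction of [hom_linear_r] to [H]. The element
    [e] is a unit only on [H], so it may be an idempotent such as iota_1. *)
Record homogeneous_subalgebra (F : fieldType) (V : lmodType F)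
    (m : V -> V -> V) (e : V) (H : bool -> V -> Prop) : Prop := {
  hom_zero : forall b, H b 0;
  hom_comb : forall b (c : F) u v, H b u -> H b v -> H b (c *: u + v);
  hom_cap : forall v, H false v -> H true v -> v = 0;
  hom_mul : forall a b u v, H a u -> H b v -> H (a (+) b) (m u v);
  hom_one : H false e;
  hom_linear_l : forall v, linear (m^~ v);
  hom_linear_r : forall a u, H a u -> linear (m u);
  hom_assoc : forall u v w, m u (m v w) = m (m u v) w;
  hom_mul1 : forall a u, H a u -> m e u = u;
  hom_comm : forall a b u v, H a u -> H b v -> m u v = (-1) ^+ (a && b) *: m v u }.

Section HomogeneousSubalgebra.
Context {F : fieldType} {V : lmodType F} {m : V -> V -> V} {e : V}.
Context {H : bool -> V -> Prop} (hH : homogeneous_subalgebra m e H).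

(* The proof argument lets the submodule instance below be inferred. *)
Definition hom_span (_ : homogeneous_subalgebra m e H) : {pred V} :=
  fun v => `[< exists u w, [/\ H false u, H true w & v = u + w] >].

Lemma hom_spanP v :
  reflect (exists u w, [/\ H false u, H true w & v = u + w]) (v \in hom_span hH).
Proof. exact: asboolP. Qed.

Lemma hom_span_closed : submod_closed (hom_span hH).
Proof.
split=> [|c _ _ /hom_spanP[u0 [u1 [hu0 hu1 ->]]] /hom_spanP[v0 [v1 [hv0 hv1 ->]]]].
  by apply/hom_spanP; exists 0, 0; rewrite addr0; split=> //; apply: (hom_zero hH).
apply/hom_spanP; exists (c *: u0 + v0), (c *: u1 + v1).
by split; [exact: (hom_comb hH)|exact: (hom_comb hH)|
           rewrite scalerDr addrACA].
Qed.

HB.instance Definition _ :=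
  GRing.isSubmodClosed.Build F V (hom_span hH) hom_span_closed.

Record hom_alg := HomAlg { hom_val :> V; _ : hom_val \in hom_span hH }.
HB.instance Definition _ := [isSub for hom_val].
HB.instance Definition _ := [Choice of hom_alg by <:].
HB.instance Definition _ := [SubChoice_isSubLmodule of hom_alg by <:].

Lemma mem_hom b v : H b v -> v \in hom_span hH.
Proof.
case: b => hv; apply/hom_spanP; [exists 0, v|exists v, 0];
  by rewrite ?addr0 ?add0r; split=> //; apply: (hom_zero hH).
Qed.

Definition hom_elt b v (hv : H b v) : hom_alg := HomAlg (mem_hom hv).

Lemma hom_val_linear : linear hom_val.
Proof. by move=> c x y; rewrite -(linearP (val : hom_alg -> V)). Qed.

Definition hom_par b (x : hom_alg) : Prop := H b x.

Lemma hom_par_zero b : hom_par b 0.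
Proof.
rewrite /hom_par.
by have -> : hom_val 0 = 0 := raddf0 (val : hom_alg -> V); apply: (hom_zero hH).
Qed.

Lemma hom_par_comb b (c : F) x y :
  hom_par b x -> hom_par b y -> hom_par b (c *: x + y).
Proof. by rewrite /hom_par hom_val_linear; apply: (hom_comb hH). Qed.

Lemma hom_par_sum x : exists u w, [/\ hom_par false u, hom_par true w & x = u + w].
Proof.
have [u [w [hu hw xE]]] := hom_spanP _ (valP x).
exists (hom_elt hu), (hom_elt hw); split=> //.
by apply: val_inj; rewrite raddfD.
Qed.

Lemma hom_par_cap x : hom_par false x -> hom_par true x -> x = 0.
Proof.
by move=> h0 h1; apply: val_inj; rewrite raddf0; apply: (hom_cap hH h0 h1).
Qed.

Definition hom_superspace : superspace F :=
  Superspace hom_par_zero hom_par_comb hom_par_sum hom_par_cap.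

Lemma hom_mulDl u v w : m (u + v) w = m u w + m v w.
Proof. by have /= := hom_linear_l hH w 1 u v; rewrite !scale1r. Qed.

Lemma hom_span_linear_r u : u \in hom_span hH -> linear (m u).
Proof.
move=> /hom_spanP[u0 [u1 [h0 h1 ->]]] c v w; rewrite !hom_mulDl.
by rewrite (hom_linear_r hH h0) (hom_linear_r hH h1) scalerDr addrACA.
Qed.

Lemma hom_span_mul u v :
  u \in hom_span hH -> v \in hom_span hH -> m u v \in hom_span hH.
Proof.
move=> hu /hom_spanP[v0 [v1 [hv0 hv1 ->]]].
have /= := hom_span_linear_r hu 1 v0 v1; rewrite !scale1r => ->.
move: hu => /hom_spanP[u0 [u1 [hu0 hu1 ->]]]; rewrite !hom_mulDl.
by rewrite !rpredD //; apply: mem_hom; apply: (hom_mul hH); eassumption.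
Qed.

Definition hom_smul (x y : hom_superspace) : hom_superspace :=
  HomAlg (hom_span_mul (valP x) (valP y)).

Definition hom_sone : hom_superspace := hom_elt (hom_one hH).

Lemma hom_smul_bilinear : bilinear_map hom_smul.
Proof.
split=> x c y z; apply: val_inj; rewrite [RHS]hom_val_linear.
  exact: (hom_span_linear_r (valP x)).
exact: (hom_linear_l hH).
Qed.

Lemma hom_smul_even a b x y :
  par a x -> par b y -> par (a (+) b) (hom_smul x y).
Proof. exact: (hom_mul hH). Qed.

Lemma hom_smulA x y z : hom_smul x (hom_smul y z) = hom_smul (hom_smul x y) z.
Proof. by apply: val_inj; apply: (hom_assoc hH). Qed.

Lemma hom_smul1 x : hom_smul hom_sone x = x.
Proof.
have [u [w [hu hw ->]]] := par_sum x; apply: val_inj.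
have /= := hom_linear_r hH (hom_one hH) 1 (hom_val u) (hom_val w).
by rewrite !scale1r (hom_mul1 hH hu) (hom_mul1 hH hw).
Qed.

Lemma hom_smulC a b x y :
  par a x -> par b y -> hom_smul x y = (-1) ^+ (a && b) *: hom_smul y x.
Proof. by move=> hx hy; apply: val_inj; rewrite linearZ; apply: (hom_comm hH). Qed.

Definition hom_superalgebra : com_superalgebra F :=
  ComSuperalgebra hom_smul_bilinear hom_smul_even (hom_one hH : par false hom_sone)
    hom_smulA hom_smul1
    hom_smulC.

End HomogeneousSubalgebra.

(** * Rules for functions known to be linear *)

Section LinearFunctions.
Variables (F : fieldType) (U W : lmodType F) (f : U -> W).
Hypothesis f_lin : linear f.

Lemma linear_fun0 : f 0 = 0.
Proof. by have := f_lin (-1) 0 0; rewrite scaleN1r oppr0 addr0 scaleN1r addNr. Qed.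

Lemma linear_funD : {morph f : u v / u + v}.
Proof. by move=> u v; have := f_lin 1 u v; rewrite !scale1r. Qed.

Lemma linear_funZ c : {morph f : u / c *: u}.
Proof. by move=> u; have := f_lin c u 0; rewrite linear_fun0 !addr0. Qed.

Lemma linear_funB : {morph f : u v / u - v}.
Proof. by move=> u v; rewrite -!(scaleN1r v) linear_funD linear_funZ scaleN1r. Qed.

End LinearFunctions.

Lemma linear_fun_sub (F : fieldType) (U W : lmodType F) (f h : U -> W) :
  linear f -> linear h -> linear (fun u => f u - h u).
Proof. by move=> hf hh c u v; rewrite hf hh opprD addrACA scalerBr. Qed.

Lemma linear_fun_scale (F : fieldType) (U W : lmodType F) (f : U -> W) c :
  linear f -> linear (fun u => c *: f u).
Proof. by move=> hf k u v; rewrite hf scalerDr !scalerA mulrC. Qed.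

Lemma linear_fun_comp (F : fieldType) (U V W : lmodType F) (f : V -> W) (h : U -> V) :
  linear f -> linear h -> linear (fun u => f (h u)).
Proof. by move=> hf hh k u v; rewrite hh hf. Qed.

(** * Induction on homogeneous elements of the symmetric superalgebra *)

Section SymmetricInduction.
Variables (F : fieldType) (g : lie_superalgebra F) (A : comAlgType F).
Variables (E : lie_superalgebroid g A).
Variable S : @symmetric_superalgebra F A (Pi g) (amod E).

Lemma sym_incl_scalar f : sym_incl S (0, f) = sym_scalar S f.
Proof. by rewrite /sym_incl (linear_fun0 (under_mod_linear (sym_under S))) add0r. Qed.

Lemma sym_incl_gen X : sym_incl S (X, 0) = sym_gen S X.
Proof. by rewrite /sym_incl (linear_fun0 (under_linear (sym_under S))) addr0. Qed.

Lemma sym_incl_even b x : @par F (Pi (semidirect E)) b x -> par b (sym_incl S x).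
Proof.
have U := sym_under S; case: x => X f [/= hX hf].
rewrite /sym_incl -[sym_gen S X]scale1r; apply: par_comb.
  by rewrite /=; apply: (under_mod_even U).
case: b hX hf => /= _; last by move=> _; exact: under_even U _.
by move=> ->; rewrite (linear_fun0 (under_linear U)); exact: par_zero.
Qed.

Lemma semidirect_scalar_par f : @par F (Pi (semidirect E)) false (0, f).
Proof. by split=> //; apply: par_zero. Qed.

Lemma semidirect_gen_par b X :
  @par F (Pi g) b X -> @par F (Pi (semidirect E)) b (X, 0).
Proof. by move=> hX; split=> //; case: b hX. Qed.

(* The homogeneous elements satisfying [P] span a subalgebra containing the
   generators, so the universal property retracts [S] onto it. *)
Lemma sym_ind (P : bool -> S -> Prop) :
  (forall b, P b 0) ->
  (forall b (c : F) x y, P b x -> P b y -> P b (c *: x + y)) ->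
  (forall b x, @par F (Pi (semidirect E)) b x -> P b (sym_incl S x)) ->
  (forall a b x y, par a x -> P a x -> par b y -> P b y ->
    P (a (+) b) (smul x y)) ->
  forall b x, par b x -> P b x.
Proof.
move=> P0 Pcomb Pgen Pmul; have U := sym_under S.
have [mul_linr mul_linl] := smul_bilinear S.
(* Parity is joined to [P] so that the two components meet in 0 and supercommutativity is inherited
   from [S]. *)
pose H b x := par b x /\ P b x.
have Hincl b x : @par F (Pi (semidirect E)) b x -> H b (sym_incl S x).
  by move=> hx; split; [exact: sym_incl_even|exact: Pgen].
have Hscal f : H false (sym_scalar S f).
  by rewrite -sym_incl_scalar; apply/Hincl/semidirect_scalar_par.
have hH : homogeneous_subalgebra (@smul F S) (sone S) H.
  split=> //.
  - by move=> b; split=> //; exact: par_zero.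
  - by move=> b c u v [? ?] [? ?]; split; [exact: par_comb|exact: Pcomb].
  - by move=> v [h0 _] [h1 _]; exact: par_cap h0 h1.
  - by move=> a b u v [? ?] [? ?]; split; [exact: smul_even|exact: Pmul].
  - by rewrite -(under_one U).
  - exact: smulA.
  - by move=> a u _; exact: smul1.
  - by move=> a b u v [hu _] [hv _]; exact: smulC.
have Hgen X : sym_gen S X \in hom_span hH.
  have [X0 [X1 [h0 h1 ->]]] := par_sum (X : Pi g).
  rewrite (linear_funD (under_mod_linear U)) -!sym_incl_gen.
  by rewrite rpredD //; [apply: (mem_hom _ (b := false))|apply: (mem_hom _ (b := true))];
     apply/Hincl/semidirect_gen_par.
pose B := hom_superalgebra hH.
pose phi (f : A) : B := hom_elt hH (Hscal f).
pose psi (X : Pi g) : B := HomAlg (Hgen X).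
have BU : @is_superalgebra_under F A (Pi g) (amod E) B phi psi.
  split.
  - by move=> c f h; apply: val_inj; rewrite [RHS]hom_val_linear; exact: (under_linear U).
  - exact: Hscal.
  - by apply: val_inj; exact: under_one U.
  - by move=> f h; apply: val_inj; exact: under_mul U _ _.
  - by move=> c X Y; apply: val_inj; rewrite [RHS]hom_val_linear;
       exact: (under_mod_linear U).
  - move=> b X hX.
    change (H b (sym_gen S X)); rewrite -sym_incl_gen.
    exact/Hincl/semidirect_gen_par.
  - by move=> f X; apply: val_inj; exact: under_act U _ _.
have [h [hmor hphi hpsi]] := sym_ex S BU.
pose r (x : S) : S := hom_val (h x).
have rmor : is_superalgebra_morphism r.
  split=> [c x y|b x hx||x y].
  - by rewrite /r (smorph_linear hmor) hom_val_linear.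
  - exact: (proj1 (smorph_even hmor hx)).
  - by rewrite /r (smorph_one hmor).
  - by rewrite /r (smorph_mul hmor).
(* [r] is the map to the subalgebra followed by inclusion. It fixes scalars and generators, so
   uniqueness in the universal property makes it the identity; thus every homogeneous x = r x lies
   in [H]. *)
have rid : r =1 id.
  apply: (sym_uniq rmor) => [|f|X]; first by split.
  - by rewrite /r /= (hphi f : h (sym_scalar S f) = _).
  - by rewrite /r /= (hpsi X : h (sym_gen S X) = _).
by move=> b x hx; have [_] : H b (r x) := smorph_even hmor hx; rewrite rid.
Qed.

End SymmetricInduction.

(** * Construction of the contraction *)

Section Contraction.
Variables (F : fieldType) (g : lie_superalgebra F) (A : comAlgType F).
Variables (E : lie_superalgebroid g A) (Om : complex F).
Variable io : algebroid_complex E Om.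

(** The parity index makes the sign rules provable by induction on how an operator is built. The
    identity is left out, since composing it with iota_1 gives iota_1, which may differ from it. *)
Inductive iota_op : bool -> (Om -> Om) -> Prop :=
| iota_op0 b : iota_op b 0
| iota_op_comb b (c : F) P Q : iota_op b P -> iota_op b Q -> iota_op b (c *: P + Q)
| iota_op_gen b x : @par F (Pi (semidirect E)) b x -> iota_op b (cx_iota io x)
| iota_op_mul a b P Q : iota_op a P -> iota_op b Q -> iota_op (a (+) b) (P \o Q).

Lemma iota_op_linear b P : iota_op b P -> linear P.
Proof.
elim=> {b P} [b|b c P Q _ hP _ hQ|b x _|a b P Q _ hP _ hQ] k u v.
- by change ((0 : Om) = k *: 0 + 0); rewrite scaler0 addr0.
- change (c *: P (k *: u + v) + Q (k *: u + v)
          = k *: (c *: P u + Q u) + (c *: P v + Q v)).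
  by rewrite hP hQ !scalerDr !scalerA mulrC addrACA.
- exact: linearP.
- by rewrite /= hQ hP.
Qed.

Lemma iota_op_even b P : iota_op b P -> End_par b P.
Proof.
elim=> {b P} [b|b c P Q _ hP _ hQ|b x hx|a b P Q _ hP _ hQ] b' v hv.
- exact: par_zero.
- by apply: par_comb; [exact: hP|exact: hQ].
- exact: cx_iota_even hx _ _ hv.
- by rewrite -addbA; apply/hP/hQ.
Qed.

(** On generators this is iota_1 iota_X = iota_{1X} and iota_1 iota_f = iota_{1f}; for a product the
    outer factor decides. *)
Lemma iota_op_unit b P : iota_op b P -> forall v, cx_iota io (0, 1) (P v) = P v.
Proof.
elim=> {b P} [b|b c P Q _ hP _ hQ|b [X f] _|a b P Q _ hP _ hQ] v.
- by change (cx_iota io (0, 1) 0 = 0); rewrite linear0.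
- change (cx_iota io (0, 1) (c *: P v + Q v) = c *: P v + Q v).
  by rewrite linearP hP hQ.
- have -> : ((X, f) : semidirect E) = (X, 0) + (0, f) by congr pair; rewrite ?addr0 ?add0r.
  rewrite (linear_funD (cx_iota_linear io v)) linearD.
  have -> : cx_iota io (0, 1) (cx_iota io (X, 0) v) = cx_iota io (X, 0) v.
    by rewrite -[in RHS](amod1 E X) (ac_iota_amod io).
  by have /= <- := ac_iota_mul io 1 f v; rewrite mul1r.
- by rewrite /= hP.
Qed.

(** First of two inductions: a generator is moved past [Q] here, and [iota_op_comm] then inducts on
    the left operator. Signs add up over products because [&&] distributes over [(+)]. *)
Lemma iota_op_comm_gen a b x Q v :
  @par F (Pi (semidirect E)) a x -> iota_op b Q ->
  cx_iota io x (Q v) = (-1) ^+ (a && b) *: Q (cx_iota io x v).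
Proof.
move=> hx hQ; elim: hQ v => {b Q} [b|b c P Q _ hP _ hQ|b y hy|b b' P Q hP IP _ IQ] v.
- by change (cx_iota io x 0 = (-1) ^+ (a && b) *: 0); rewrite linear0 scaler0.
- change (cx_iota io x (c *: P v + Q v)
    = (-1) ^+ (a && b) *: (c *: P (cx_iota io x v) + Q (cx_iota io x v))).
  by rewrite linearP hP hQ scalerDr !scalerA mulrC.
- apply/eqP; rewrite -subr_eq0; apply/eqP. exact: (cx_iota_comm io hx hy v).
- rewrite /= IP IQ (linear_funZ (iota_op_linear hP)) scalerA -signr_addb.
  by rewrite -andb_addr.
Qed.

Lemma iota_op_comm a b P Q v : iota_op a P -> iota_op b Q ->
  P (Q v) = (-1) ^+ (a && b) *: Q (P v).
Proof.
move=> hP hQ.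
elim: hP v => {a P} [a|a c P R _ hP _ hR|a x hx|a a' P R hP IP _ IR] v.
- by change (0 = (-1) ^+ (a && b) *: Q 0); rewrite (linear_fun0 (iota_op_linear hQ)) scaler0.
- change (c *: P (Q v) + R (Q v) = (-1) ^+ (a && b) *: Q (c *: P v + R v)).
  by rewrite (iota_op_linear hQ) hP hR scalerDr !scalerA mulrC.
- exact: iota_op_comm_gen.
- rewrite /= IR (linear_funZ (iota_op_linear hP)) IP scalerA -signr_addb.
  by rewrite -andb_addl addbC.
Qed.

Lemma iota_op_subalgebra :
  homogeneous_subalgebra (fun P Q : Om -> Om => P \o Q) (cx_iota io (0, 1)) iota_op.
Proof.
split.
- exact: iota_op0.
- exact: iota_op_comb.
(* An operator that is both even and odd sends each homogeneous vector into both components, hence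
   to 0. *)
- move=> P h0 h1; apply/funext => v.
  have [v0 [v1 [hv0 hv1 ->]]] := par_sum v.
  rewrite (linear_funD (iota_op_linear h0)).
  have -> := par_cap (iota_op_even h0 hv0) (iota_op_even h1 hv0).
  have -> := par_cap (iota_op_even h1 hv1) (iota_op_even h0 hv1).
  by rewrite addr0.
- exact: iota_op_mul.
- by apply: iota_op_gen; exact: semidirect_scalar_par.
- by move=> Q c P P'.
- by move=> a P hP c Q Q'; apply/funext => v; exact: (iota_op_linear hP).
- by [].
- by move=> a P hP; apply/funext => v; exact: (iota_op_unit hP).
- by move=> a b P Q hP hQ; apply/funext => v; exact: (iota_op_comm v hP hQ).
Qed.

Variable S : @symmetric_superalgebra F A (Pi g) (amod E).

(** The universal property of [S] is applied to the superalgebra [B] of operators generated by the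
    given iota; [c X] is the operator underlying the image of [X]. *)
Lemma contraction_exists : exists c : S -> Om -> Om,
  [/\ forall X, linear (c X), forall v, linear (c^~ v),
      forall a X, par a X -> End_par a (c X),
      forall X Y v, c (smul X Y) v = c X (c Y v)
    & forall x, c (sym_incl S x) =1 cx_iota io x].
Proof.
pose B := hom_superalgebra iota_op_subalgebra.
have iota_lin c (x y : semidirect E) :
    (cx_iota io (c *: x + y) : Om -> Om) = c *: (cx_iota io x : Om -> Om) + cx_iota io y.
  by apply/funext => v; exact: cx_iota_linear.
have memi x : (cx_iota io x : Om -> Om) \in hom_span iota_op_subalgebra.
  have [x0 [x1 [h0 h1 ->]]] := @par_sum F (Pi (semidirect E)) x.
  rewrite -[x0]scale1r iota_lin scale1r.
  by rewrite rpredD //; [apply: (mem_hom _ (b := false))|apply: (mem_hom _ (b := true))];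
     apply: iota_op_gen.
pose i (x : semidirect E) : B := HomAlg (memi x).
have i_lin : linear i.
  by move=> c x y; apply: val_inj; rewrite [RHS]hom_val_linear; exact: iota_lin.
have BU : @is_superalgebra_under F A (Pi g) (amod E) B
    (fun f => i (0, f)) (fun X => i (X, 0)).
  split.
  - move=> c f h; rewrite -i_lin; congr (i _).
    by congr pair; rewrite /= scaler0 addr0.
  - by move=> f; apply: iota_op_gen; exact: semidirect_scalar_par.
  (* The scalar 1 goes to the unit of [B]: both are [cx_iota io (0, 1)]. *)
  - exact: val_inj.
  - by move=> f h; apply: val_inj; apply/funext => v; exact: (ac_iota_mul io).
  - move=> c X Y; rewrite -i_lin; congr (i _).
    by congr pair; rewrite /= scaler0 addr0.
  - by move=> b X hX; apply: iota_op_gen; exact: semidirect_gen_par.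
  - by move=> f X; apply: val_inj; apply/funext => v; exact: (ac_iota_amod io).
have [h [hmor hphi hpsi]] := sym_ex S BU.
pose c (X : S) : Om -> Om := hom_val (h X).
have c_lin v : linear (c^~ v).
  by move=> k X Y; rewrite /c (smorph_linear hmor) hom_val_linear.
exists c; split=> //.
- move=> X; have [X0 [X1 [h0 h1 ->]]] := par_sum X.
  have L0 : linear (c X0) := iota_op_linear (smorph_even hmor h0).
  have L1 : linear (c X1) := iota_op_linear (smorph_even hmor h1).
  move=> k u v; rewrite !(linear_funD (c_lin _)) L0 L1.
  by rewrite scalerDr addrACA.
- by move=> a X hX; exact: (iota_op_even (smorph_even hmor hX)).
- by move=> X Y v; rewrite /c (smorph_mul hmor).
- move=> [X f] v; rewrite (linear_funD (c_lin v)) /c.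
  rewrite (hpsi X : h (sym_gen S X) = _) (hphi f : h (sym_scalar S f) = _) /=.
  rewrite -(linear_funD (cx_iota_linear io v)); congr (cx_iota io _ v).
  by congr pair; rewrite ?addr0 ?add0r.
Qed.

End Contraction.

(** * Supercommutator identities *)

Section Supercommutator.
Variables (F : fieldType) (V : superspace F).
Implicit Types P Q R : V -> V.

Lemma supercomm_linear a b P Q : linear P -> linear Q -> linear (supercomm a b P Q).
Proof.
move=> hP hQ; apply: linear_fun_sub; last apply: linear_fun_scale;
  exact: linear_fun_comp.
Qed.

(** The two terms [P (R (Q v))] cancel. With [R] the differential this yields the 0-right Leibniz
    rule; with [R] a contraction it drives the induction on X in [cartan_contr]. *)
Lemma supercomm_mull a b c P Q R v : linear P ->
  supercomm (a (+) b) c (P \o Q) R v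
  = P (supercomm b c Q R v) + (-1) ^+ (b && c) *: supercomm a c P R (Q v).
Proof.
move=> P_lin; rewrite /supercomm /= (linear_funB P_lin) (linear_funZ P_lin).
by rewrite scalerBr scalerA -signr_addb addrA subrK -andb_addl addbC.
Qed.

Lemma supercomm_mulr a b c P Q R v : linear Q ->
  supercomm a (b (+) c) P (Q \o R) v
  = supercomm a b P Q (R v) + (-1) ^+ (a && b) *: Q (supercomm a c P R v).
Proof.
move=> Q_lin; rewrite /supercomm /= (linear_funB Q_lin) (linear_funZ Q_lin).
by rewrite scalerBr scalerA -signr_addb addrA subrK -andb_addr.
Qed.

(* The Jacobi identity, whose term [[Q, [P, R]]] vanishes. *)
Lemma supercomm_jacobi a b c P Q R v : linear P -> linear Q -> linear R ->
  (forall w, P (R w) = (-1) ^+ (a && c) *: R (P w)) ->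
  supercomm a (b (+) c) P (supercomm b c Q R) v
  = supercomm (a (+) b) c (supercomm a b P Q) R v.
Proof.
move=> P_lin Q_lin R_lin PR; rewrite /supercomm.
rewrite (linear_funB P_lin) (linear_funZ P_lin) (linear_funB R_lin) (linear_funZ R_lin).
rewrite !PR (linear_funZ Q_lin) !scalerBr !scalerA -!signr_addb.
(* Once [PR] has moved [R] to the left of [P], both sides consist of the products PQR, RPQ, QRP and
   RQP; [swap] aligns them, and the signs are compared for all eight choices of parities. *)
have swap (x y z w : V) : x - y - (z - w) = x - z - (y - w).
  by rewrite !opprB [LHS]addrACA [RHS]addrACA (addrC (- y)).
rewrite swap; congr (_ - _ *: _ - (_ *: _ - _ *: _)).
all: by congr (_ ^+ nat_of_bool _); case: a b c {PR} => [] [] [].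
Qed.

End Supercommutator.

(** * Homogeneous components and the parity involution *)

Section Parity.
Variables (F : fieldType) (V : superspace F).

Lemma par_scale b c (v : V) : par b v -> par b (c *: v).
Proof. by move=> hv; rewrite -[_ *: _]addr0; apply: par_comb => //; apply: par_zero. Qed.

Lemma par_sub b (u v : V) : par b u -> par b v -> par b (u - v).
Proof. by move=> hu hv; rewrite addrC -scaleN1r; apply: par_comb. Qed.

Lemma par_decomp (u w u' w' : V) : par false u -> par true w ->
  par false u' -> par true w' -> u + w = u' + w' -> u = u' /\ w = w'.
Proof.
move=> hu hw hu' hw' E.
have E' : u - u' = w' - w.
  by apply/eqP; rewrite subr_eq addrAC eq_sym subr_eq eq_sym (addrC w') E.
have e0 : u - u' = 0 by apply: par_cap; [|rewrite E']; exact: par_sub.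
by split; apply/eqP; rewrite -subr_eq0 ?e0 // -opprB -E' e0 oppr0.
Qed.

(** The sign in [iota_X, d] depends on the parity of X, so a Lie derivative linear in arbitrary X
    needs this involution. A superspace only asserts that components exist: they are picked by
    choice, and their uniqueness gives linearity. *)
Lemma parity_involution_exists : exists s : V -> V,
  linear s /\ forall b v, par b v -> s v = (-1) ^+ b *: v.
Proof.
have /choice[p hp] : forall v : V, exists p : V * V,
    [/\ par false p.1, par true p.2 & v = p.1 + p.2].
  by move=> v; have [u [w ?]] := par_sum v; exists (u, w).
exists (fun v => (p v).1 - (p v).2); split=> [c u v|b v hv].
  have [u0 u1 eu] := hp u; have [v0 v1 ev] := hp v; have [w0 w1 ew] := hp (c *: u + v).
  have [|-> ->] := par_decomp w0 w1 (par_comb c u0 v0) (par_comb c u1 v1).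
    by rewrite -ew [in LHS]eu [in LHS]ev scalerDr addrACA.
  by rewrite scalerBr opprD addrACA.
have [v0 v1 ev] := hp v; case: b hv => hv.
  have [|-> ->] := par_decomp v0 v1 (par_zero V false) hv; first by rewrite add0r.
  by rewrite sub0r scaleN1r.
have [|-> ->] := par_decomp v0 v1 hv (par_zero V true); first by rewrite addr0.
by rewrite subr0 scale1r.
Qed.

Lemma Pi_par b (v : V) : par b v -> @par F (Pi V) (~~ b) v.
Proof. by rewrite /= negbK. Qed.

End Parity.

(** Skewcommutativity turns the bracket into [Y, X X'], where the given Leibniz rule applies; each
    resulting bracket is then flipped back. *)
Lemma ger_leibniz_l (F : fieldType) (G : gerstenhaber_algebra F) a a' b
    (X X' Y : G) : par a X -> par a' X' -> par b Y ->
  ger_bracket (smul X X') Y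
  = smul X (ger_bracket X' Y) + (-1) ^+ (a' && ~~ b) *: smul (ger_bracket X Y) X'.
Proof.
move=> hX hX' hY; have [[_ _ skew _] leib] := ger_bracketP G.
have [smr sml] := smul_bilinear G.
rewrite (skew _ _ _ _ (Pi_par (smul_even hX hX')) (Pi_par hY)) (leib _ _ _ _ _ hY hX).
rewrite (skew _ _ _ _ (Pi_par hX) (Pi_par hY)) (skew _ _ _ _ (Pi_par hX') (Pi_par hY)).
rewrite -!scaleNr (linear_funZ (smr _)) (linear_funZ (sml _)).
rewrite scalerDr !scalerA [in RHS]addrC; congr (_ *: _ + _ *: _).
all: by case: a a' b {hX hX' hY} => [] [] [] /=; rewrite ?(mulrN, mulNr, mul1r, opprK).
Qed.

(** * Cartan calculus for a given contraction *)

Section Calculus.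
Variables (F : fieldType) (g : lie_superalgebra F) (A : comAlgType F).
Variables (E : lie_superalgebroid g A) (S : schouten_algebra E) (Om : complex F).
Variables (io : algebroid_complex E Om).
Local Notation G := (schouten_gerstenhaber S).
Variable c : G -> Om -> Om.
Hypothesis c_linear : forall X, linear (c X).
Hypothesis c_linear_l : forall v, linear (c^~ v).
Hypothesis c_even : forall a X, par a X -> End_par a (c X).
Hypothesis c_mul : forall X Y v, c (smul X Y) v = c X (c Y v).
Hypothesis c_incl : forall x, c (sym_incl (sch_sym S) x) =1 cx_iota io x.

(** The parity is a separate parameter, so that for fixed [a] the expression is linear in all [X],
    homogeneous or not. *)
Let L (a : bool) (X : G) : Om -> Om := supercomm a true (c X) (diff Om).

Lemma diff_linear : linear (diff Om).
Proof. by move=> k u v; rewrite linearP. Qed.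

Lemma cartan_linear a X : linear (L a X).
Proof. by apply: supercomm_linear => //; exact: diff_linear. Qed.

Lemma cartan_linear_l a v : linear (fun X => L a X v).
Proof.
apply: linear_fun_sub; first exact: c_linear_l.
by apply: linear_fun_scale; apply: linear_fun_comp; [exact: diff_linear|exact: c_linear_l].
Qed.

Lemma cartan_even a X : par a X -> End_par (~~ a) (L a X).
Proof.
move=> hX b v hv; rewrite /L /supercomm; apply: par_sub.
  by rewrite addNb -addbN; exact/c_even/diff_odd.
by apply: par_scale; rewrite addNb; exact/diff_odd/c_even.
Qed.

Lemma cartan_mul a b X Y v : par a X -> par b Y ->
  L (a (+) b) (smul X Y) v = c X (L b Y v) + (-1) ^+ b *: L a X (c Y v).
Proof.
move=> hX hY; have -> : L (a (+) b) (smul X Y) v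
    = supercomm (a (+) b) true (c X \o c Y) (diff Om) v.
  by rewrite /L /supercomm /= !c_mul.
by rewrite supercomm_mull // andbT.
Qed.

Lemma ger_bracket_linear_r (X : G) : linear (ger_bracket X).
Proof. exact: (proj1 (lie_bilinear (ger_lie (ger_bracketP G))) X). Qed.

Lemma ger_bracket_linear_l (Y : G) : linear ((@ger_bracket F G)^~ Y).
Proof. exact: (proj2 (lie_bilinear (ger_lie (ger_bracketP G))) Y). Qed.

(** Linearity in [X] and in [Y] makes the vanishing of this difference stable under the linear
    combinations that [sym_ind] asks for. *)
Let defect a b (X Y : G) v : Om :=
  supercomm (~~ a) b (L a X) (c Y) v - c (ger_bracket X Y) v.

Lemma defect_linear_l a b Y v : linear (fun X => defect a b X Y v).
Proof.
apply: linear_fun_sub; last exact: (linear_fun_comp (c_linear_l v) (ger_bracket_linear_l Y)).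
apply: linear_fun_sub; first exact: cartan_linear_l.
by apply: linear_fun_scale; apply: linear_fun_comp; [exact: c_linear|exact: cartan_linear_l].
Qed.

Lemma defect_linear_r a b X v : linear (fun Y => defect a b X Y v).
Proof.
apply: linear_fun_sub; last exact: (linear_fun_comp (c_linear_l v) (ger_bracket_linear_r X)).
apply: linear_fun_sub; first by apply: linear_fun_comp; [exact: cartan_linear|].
by apply: linear_fun_scale; exact: c_linear_l.
Qed.

(** Base case: the bracket axiom of the complex, combined with the Schouten bracket extending that
    of the semidirect product. *)
Lemma cartan_contr_incl a b x y v :
  @par F (Pi (semidirect E)) a x -> @par F (Pi (semidirect E)) b y ->
  defect a b (sym_incl (sch_sym S) x) (sym_incl (sch_sym S) y) v = 0.
Proof.
move=> hx hy; apply/eqP; rewrite subr_eq0.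
have -> : @ger_bracket F G (sym_incl (sch_sym S) x) (sym_incl (sch_sym S) y)
    = sym_incl (sch_sym S) (bracket x y) := sch_extends S x y.
rewrite c_incl.
rewrite -(cx_iota_bracket io hx hy) addbT /L /supercomm.
by rewrite !c_incl.
Qed.

(** Induction on [Y]: supercommutation with L_x and bracketing with x obey the same Leibniz rule,
    with equal signs. *)
Lemma cartan_contr_incl_l a b x Y v :
  @par F (Pi (semidirect E)) a x -> par b Y ->
  defect a b (sym_incl (sch_sym S) x) Y v = 0.
Proof.
move=> hx hY; move: b Y hY v.
apply: (@sym_ind _ _ _ _ (sch_sym S)
  (fun b Y => forall v, defect a b (sym_incl (sch_sym S) x) Y v = 0)).
- by move=> b v; rewrite (linear_fun0 (defect_linear_r _ _ _ v)).
- move=> b k Y Z hY hZ v.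
  by rewrite (defect_linear_r _ _ _ v) hY hZ scaler0 addr0.
- by move=> b y hy v; exact: cartan_contr_incl.
- move=> b b' Y Z hY IY hZ IZ v; apply/eqP; rewrite subr_eq0.
  have hX := sym_incl_even (sch_sym S) hx.
  rewrite (ger_leibniz (ger_bracketP G) _ hX hY) (linear_funD (c_linear_l v)).
  rewrite (linear_funZ (c_linear_l v)) !c_mul addbT.
  have -> : supercomm (~~ a) (b (+) b') (L a (sym_incl (sch_sym S) x)) (c (smul Y Z)) v
      = supercomm (~~ a) (b (+) b') (L a (sym_incl (sch_sym S) x)) (c Y \o c Z) v.
    by rewrite /supercomm /= !c_mul.
  rewrite supercomm_mulr //.
  by rewrite (subr0_eq (IY _)) (subr0_eq (IZ _)).
Qed.

Lemma contr_comm a b X Y v : par a X -> par b Y ->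
  supercomm a b (c X) (c Y) v = 0.
Proof.
move=> hX hY; rewrite /supercomm -!c_mul (smulC hX hY) (linear_funZ (c_linear_l v)).
by rewrite subrr.
Qed.

Lemma cartan_contr a b X Y v : par a X -> par b Y ->
  supercomm (~~ a) b (L a X) (c Y) v = c (ger_bracket X Y) v.
Proof.
move=> hX hY; apply: subr0_eq; move: a X hX v.
apply: (@sym_ind _ _ _ _ (sch_sym S) (fun a X => forall v, defect a b X Y v = 0)).
- by move=> a v; rewrite (linear_fun0 (defect_linear_l _ _ _ v)).
- move=> a k X Z hX hZ v.
  by rewrite (defect_linear_l _ _ _ v) hX hZ scaler0 addr0.
- by move=> a x hx v; exact: cartan_contr_incl_l.
- move=> a a' X X' hX IX hX' IX' v; apply/eqP; rewrite subr_eq0.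
  rewrite (ger_leibniz_l (G := G) hX hX' hY) (linear_funD (c_linear_l v)).
  rewrite (linear_funZ (c_linear_l v)) !c_mul.
  (* The 0-right Leibniz rule splits L of the product into two composites. Expanding each with
     [supercomm_mull], the brackets of two contractions vanish, and what remains matches
     [ger_leibniz_l]. *)
  have -> : supercomm (~~ (a (+) a')) b (L (a (+) a') (smul X X')) (c Y) v
      = supercomm (a (+) ~~ a') b (c X \o L a' X') (c Y) v
        + (-1) ^+ a' *: supercomm (~~ a (+) a') b (L a X \o c X') (c Y) v.
    rewrite /supercomm /= !(cartan_mul _ hX hX') (linear_funD (c_linear Y)).
    rewrite (linear_funZ (c_linear Y)) addbN addNb.
    by rewrite [X in _ - X]scalerDr opprD addrACA scalerA mulrC -scalerA -scalerBr.
  rewrite !supercomm_mull //; last exact: cartan_linear.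
  rewrite !(contr_comm _ _ hY) // (linear_fun0 (cartan_linear _ _)) scaler0 addr0 add0r.
  rewrite (subr0_eq (IX _)) (subr0_eq (IX' _)) scalerA -signr_addb.
  apply/eqP; congr (_ + _ ^+ nat_of_bool _ *: _).
  by case: a' b {IX hX' hY IX'} => [] [].
Qed.

(** Since d squares to 0, only the term d iota_X d survives on either side. *)
Lemma cartan_diff a X v :
  L a X (diff Om v) = (-1) ^+ (~~ a) *: diff Om (L a X v).
Proof.
rewrite /L /supercomm diff_sq (linear_fun0 (c_linear X)) andbT.
rewrite (linear_funB diff_linear) (linear_funZ diff_linear) diff_sq scaler0 subr0.
by rewrite sub0r; case: a; rewrite /= ?scale1r ?scaleN1r ?opprK.
Qed.

(** Jacobi for L_X, iota_Y and d: as [L_X, d] = 0, [L_X, [iota_Y, d]] = [[L_X, iota_Y], d] =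
    [iota_[X,Y], d]. *)
Lemma cartan_bracket a b X Y v : par a X -> par b Y ->
  L (~~ a (+) b) (ger_bracket X Y) v = supercomm (~~ a) (~~ b) (L a X) (L b Y) v.
Proof.
move=> hX hY; rewrite -[~~ b in RHS]addbT.
rewrite supercomm_jacobi //; first 1 last.
- exact: cartan_linear.
- exact: diff_linear.
- by move=> w; rewrite andbT; exact: cartan_diff.
by rewrite {1}/L /supercomm -!(cartan_contr _ hX hY).
Qed.

End Calculus.

(** * Existence and uniqueness of the calculus structure *)

Definition linear_map (F : fieldType) (U W : lmodType F) (f : U -> W)
    (f_lin : linear f) : {linear U -> W} :=
  HB.pack f (GRing.isLinear.Build F U W *:%R f f_lin).

Section CalculusExistence.
Variables (F : fieldType) (g : lie_superalgebra F) (A : comAlgType F).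
Variables (E : lie_superalgebroid g A) (S : schouten_algebra E) (Om : complex F).
Variables (io : algebroid_complex E Om).
Local Notation G := (schouten_gerstenhaber S).

Lemma calculus_exists : exists C : calculus G Om, extends io C.
Proof.
have [c [cl cll cev cmul cincl]] := contraction_exists io (sch_sym S).
have [s [s_lin sE]] := parity_involution_exists G.
(* The involution [s] carries the sign of Cartan's formula, so [l] is linear in [X] and agrees with
   [iota_X, d] on homogeneous [X]. *)
pose l X v := c X (diff Om v) - diff Om (c (s X) v).
have lE a (X : G) : par a X -> l X =1 supercomm a true (c X) (diff Om).
  move=> hX v; rewrite /l /supercomm (sE a X hX) (linear_funZ (cll v)) linearZ.
  by rewrite andbT.
have l_lin X : linear (l X).
  apply: linear_fun_sub; apply: linear_fun_comp => //; exact: diff_linear.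
have l_linl v : linear (l^~ v).
  apply: linear_fun_sub => //; apply: linear_fun_comp; first exact: diff_linear.
  by apply: (linear_fun_comp (cll v)).
have parN a (X : G) : @par F (Pi G) a X -> par (~~ a) X by [].
pose R := @Representation F G Om (fun X => linear_map (cl X)) cll cev
  (fun X Y v => cmul X Y v) (fun X => linear_map (l_lin X)) l_linl.
have lev a (X : G) : @par F (Pi G) a X -> End_par a (l X).
  move=> /parN hX b v hv; rewrite (lE _ _ hX).
  by have := cartan_even cev hX hv; rewrite negbK.
have lbr a b (X Y : G) : @par F (Pi G) a X -> @par F (Pi G) b Y ->
    l (ger_bracket X Y) =1 supercomm a b (l X) (l Y).
  move=> hX hY v.
  have hXY := lie_even (ger_lie (ger_bracketP G)) hX hY.
  rewrite (lE _ _ (parN _ _ hXY)).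
  have := cartan_bracket cl cll cmul cincl v (parN _ _ hX) (parN _ _ hY).
  rewrite !negbK -addbN => ->.
  by rewrite /supercomm !(lE _ _ (parN _ _ hX)) !(lE _ _ (parN _ _ hY)).
have lc a b (X Y : G) : @par F (Pi G) a X -> par b Y ->
    supercomm a b (l X) (c Y) =1 c (ger_bracket X Y).
  move=> hX hY v.
  rewrite -(cartan_contr cl cll cmul cincl v (parN _ _ hX) hY) negbK.
  by rewrite /supercomm !(lE _ _ (parN _ _ hX)).
by exists (@Calculus F G Om (R lev lbr lc) lE).
Qed.

(** Agreement of two contractions passes to products by [contr_mul], so [sym_ind] spreads it from
    the generators. *)
Lemma contr_extends_uniq (C C' : calculus G Om) :
  extends io C -> extends io C' -> forall X, contr C' X =1 contr C X.
Proof.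
move=> hC hC' X v.
have hom b (Y : sch_sym S) : par b Y -> forall w, contr C' Y w = contr C Y w.
  move: b Y; apply: sym_ind.
  - by move=> b w; rewrite !(linear_fun0 (contr_linear _ w)).
  - by move=> b k Y Z hY hZ w; rewrite !(contr_linear _ w) hY hZ.
  - by move=> b x _ w; rewrite hC hC'.
  - by move=> a b Y Z _ hY _ hZ w; rewrite (contr_mul C' Y Z) (contr_mul C Y Z) /= hZ hY.
have [X0 [X1 [h0 h1 ->]]] := par_sum X.
by rewrite !(linear_funD (contr_linear _ v)) (hom _ _ h0) (hom _ _ h1).
Qed.

Lemma lied_extends_uniq (C C' : calculus G Om) :
  extends io C -> extends io C' -> forall X, lied C' X =1 lied C X.
Proof.
move=> hC hC' X v.
have [X0 [X1 [h0 h1 ->]]] := par_sum X.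
rewrite !(linear_funD (lied_linear _ v)) !(cartan _ h0) !(cartan _ h1).
by rewrite /supercomm !(contr_extends_uniq hC hC').
Qed.

End CalculusExistence.

(** Cartan's formula and multiplicativity of the contraction suffice, so the rule holds in every
    calculus structure over any Gerstenhaber algebra. *)
Lemma lied_smul (F : fieldType) (G : gerstenhaber_algebra F) (Om : complex F)
    (C : calculus G Om) (a b : bool) (X Y : G) v : par a X -> par b Y ->
  lied C (smul X Y) v
  = contr C X (lied C Y v) + (-1) ^+ b *: lied C X (contr C Y v).
Proof.
move=> hX hY; rewrite (cartan _ (smul_even hX hY)) (cartan _ hX) (cartan _ hY).
have -> : supercomm (a (+) b) true (contr C (smul X Y)) (diff Om) v
    = supercomm (a (+) b) true (contr C X \o contr C Y) (diff Om) v.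
  by rewrite /supercomm !(contr_mul C X Y).
by rewrite supercomm_mull ?andbT // => k u w; rewrite linearP.
Qed.

Theorem theorem2p25 (F : fieldType) (F_char0 : [pchar F] =i pred0)
    (g : lie_superalgebra F) (A : comAlgType F) (E : lie_superalgebroid g A)
    (S : schouten_algebra E) (Om : complex F) (io : algebroid_complex E Om) :
  exists C : calculus (schouten_gerstenhaber S) Om,
    [/\ extends io C,
        forall C' : calculus (schouten_gerstenhaber S) Om, extends io C' ->
          forall X, contr C' X =1 contr C X /\ lied C' X =1 lied C X
      & forall (a b : bool) (X Y : schouten_gerstenhaber S),
          par a X -> par b Y ->
          forall v, lied C (smul X Y) v
            = contr C X (lied C Y v) + (-1) ^+ b *: lied C X (contr C Y v)].
Proof.
have [C hC] := calculus_exists S io; exists C; split=> //.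
- move=> C' hC' X; split.
    exact: contr_extends_uniq hC hC' X.
  exact: lied_extends_uniq hC hC' X.
- by move=> a b X Y hX hY v; exact: (lied_smul C v hX hY).
Qed.
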